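(* Let $(V,\mu)$ be a simple, strongly connected, finite weighted directed graph. Assume that $K>0$ and that $\operatorname{diam} V=\Lambda/K$. Then $$\lambda_1(V)=K.$$
   Context: **Graphs.** A finite weighted directed graph $(V,\mu)$ consists of a finite vertex set $V$ and an edge weight $\mu:V\times V\to[0,\infty)$ (not necessarily symmetric), written $\mu_{xy}=\mu(x,y)$; there is a directed edge $x\rightarrow y$ if and only if $\mu_{xy}>0$. It is simple if $\mu_{xx}=0$ for all $x\in V$. A directed path from $x$ to $y$ of length $l$ is a sequence $\{x_i\}_{i=0}^l$ with $x_0=x$, $x_l=y$, $x_i\rightarrow x_{i+1}$ for $i=0,\dots,l-1$. $(V,\mu)$ is strongly connected if for all $x,y\in V$ there is a directed path from $x$ to $y$. Graphs are assumed to have at least two vertices. The (non-symmetric) distance $d(x,y)$ is the minimum length of directed paths from $x$ to $y$; $\operatorname{diam}V=\sup_{x,y\in V}d(x,y)$. **Laplacian.** Put $\mu(x)=\sum_{y\in V}\mu_{xy}$ and $P(x,y)=\mu_{xy}/\mu(x)$. The Perron measure $\mathfrak m:V\to(0,1]$ is the unique probability measure with $\mathfrak m(x)=\sum_{y\in V}\mathfrak m(y)P(y,x)$ for all $x$. Put $\overleftarrow P(x,y)=\frac{\mathfrak m(y)}{\mathfrak m(x)}P(y,x)$ and $\mathcal P=\frac12(P+\overleftarrow P)$. The Chung Laplacian acts on $f:V\to\mathbb R$ by $\mathcal Lf(x)=f(x)-\sum_{y\in V}\mathcal P(x,y)f(y)$; it is symmetric with respect to $\mathfrak m$. With $n=|V|$,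 its eigenvalues (with multiplicity) are written $0=\lambda_0(V)<\lambda_1(V)\le\lambda_2(V)\le\dots\le\lambda_{n-1}(V)$; so $\lambda_1(V)$ is the smallest nonzero eigenvalue. **Ricci curvature.** For probability measures $\nu_0,\nu_1$ on $V$, the Wasserstein distance is $W(\nu_0,\nu_1)=\inf_\pi\sum_{x,y\in V}d(x,y)\pi(x,y)$, the infimum over all couplings $\pi$ of $(\nu_0,\nu_1)$ (i.e. $\sum_y\pi(x,y)=\nu_0(x)$, $\sum_x\pi(x,y)=\nu_1(y)$). For $\epsilon\in[0,1]$ let $\nu^\epsilon_x(z)=(1-\epsilon)\delta_x(z)+\epsilon\,\mathcal P(x,z)$, where $\delta_x$ is the Dirac measure. For $x\neq y$ let $\kappa_\epsilon(x,y)=1-\frac{W(\nu^\epsilon_x,\nu^\epsilon_y)}{d(x,y)}$ and $\kappa(x,y)=\lim_{\epsilon\to0}\kappa_\epsilon(x,y)/\epsilon$ with $\epsilon>0$ (this limit exists). Set $K:=\inf_{x\rightarrow y}\kappa(x,y)$, the infimum over all $x,y\in V$ with $x\rightarrow y$. **Mean curvature.** Let $\rho_x(z)=d(x,z)$, $\overleftarrow\rho_x(z)=d(z,x)$, $\mathcal H_x=\mathcal L\rho_x(x)$, $\overleftarrow{\mathcal H}_x=\mathcal L\overleftarrow\rho_x(x)$, $\mathcal H(x,y)=-(\mathcal H_x+\overleftarrow{\mathcal H}_y)$ for $x,y\in V$, and $\Lambda:=\sup_{x,y\in V}\mathcal H(x,y)$. *)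

(* Defs.v *)
From HB Require Import structures.
From mathcomp Require Import all_boot all_order all_algebra.
From mathcomp Require Import all_classical all_reals topology normedtype.

Set Implicit Arguments.
Unset Strict Implicit.
Unset Printing Implicit Defensive.

Import Order.TTheory GRing.Theory Num.Theory.
Import numFieldNormedType.Exports.

Local Open Scope classical_set_scope.
Local Open Scope ring_scope.

Section Digraph.
Context {R : realType} {V : finType}.
Variable mu : V -> V -> R.

Definition edge : rel V := fun x y => 0 < mu x y.

Definition has_dipath (x y : V) (l : nat) : bool :=
  [exists p : l.-tuple V, path edge x p && (last x p == y)].

Definition strongly_connected : Prop :=
  forall x y : V, exists l : nat, has_dipath x y l.

(* The value 0 is a default, used only when y cannot be reached from x. *)
Definition dist (x y : V) : nat :=
  match pselect (exists l, has_dipath x y l) with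
  | left ex => ex_minn ex
  | right _ => 0%N
  end.

Definition diam : nat := \max_(p : V * V) dist p.1 p.2.

Definition vweight (x : V) : R := \sum_(y : V) mu x y.

Definition transP (x y : V) : R := mu x y / vweight x.

Definition is_prob (nu : V -> R) : Prop :=
  (forall x, 0 <= nu x) /\ \sum_(x : V) nu x = 1.

Definition stationary (nu : V -> R) : Prop :=
  forall x, nu x = \sum_(y : V) nu y * transP y x.

(* [xget] selects the stationary probability measure, which exists and is
   unique (and positive) when the graph is strongly connected. *)
Definition perron : {ffun V -> R} :=
  xget [ffun=> 0] [set nu : {ffun V -> R} | is_prob nu /\ stationary nu].

Definition revP (x y : V) : R := perron y / perron x * transP y x.

Definition meanP (x y : V) : R := (transP x y + revP x y) / 2.

Definition laplacian (f : V -> R) (x : V) : R :=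
  f x - \sum_(y : V) meanP x y * f y.

Definition is_eigenvalue (a : R) : Prop :=
  exists f : V -> R,
    (exists x, f x != 0) /\ (forall x, laplacian f x = a * f x).

(* The smallest nonzero eigenvalue; there are finitely many eigenvalues, so the
   infimum is a minimum as soon as some eigenvalue is nonzero. *)
Definition lambda1 : R := inf [set a : R | a != 0 /\ is_eigenvalue a].

Definition coupling (nu0 nu1 : V -> R) (pi : V -> V -> R) : Prop :=
  [/\ forall x y, 0 <= pi x y,
      forall x, \sum_(y : V) pi x y = nu0 x
    & forall y, \sum_(x : V) pi x y = nu1 y].

Definition cost (pi : V -> V -> R) : R :=
  \sum_(x : V) \sum_(y : V) (dist x y)%:R * pi x y.

Definition wasserstein (nu0 nu1 : V -> R) : R :=
  inf [set cost pi | pi in coupling nu0 nu1].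

Definition lazy_walk (eps : R) (x z : V) : R :=
  (1 - eps) * (z == x)%:R + eps * meanP x z.

Definition kappa_eps (eps : R) (x y : V) : R :=
  1 - wasserstein (lazy_walk eps x) (lazy_walk eps y) / (dist x y)%:R.

Definition kappa (x y : V) : R :=
  lim ((kappa_eps eps x y / eps) @[eps --> 0^'+]).

Definition inf_ricci : R :=
  inf [set k : R | exists x y : V, edge x y /\ k = kappa x y].

Definition mean_curv_out (x : V) : R :=
  laplacian (fun z => (dist x z)%:R) x.

Definition mean_curv_in (x : V) : R :=
  laplacian (fun z => (dist z x)%:R) x.

Definition mean_curv (x y : V) : R := - (mean_curv_out x + mean_curv_in y).

Definition sup_mean_curv : R :=
  sup [set h : R | exists x y : V, h = mean_curv x y].

End Digraph.

(* Main.v *)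
Require Import Defs.
From HB Require Import structures.
From mathcomp Require Import all_boot all_order all_algebra.
From mathcomp Require Import all_classical all_reals topology normedtype.
From mathcomp Require Import realfun ring lra.

Import Order.TTheory GRing.Theory Num.Theory.
Import numFieldNormedType.Exports.
Local Open Scope ring_scope.

(* Testing couplings against 1-Lipschitz functions f (weak Kantorovich duality)
   bounds kappa(x,y) by the slope of L f between x and y whenever f has slope 1
   there, and convexity of the Wasserstein distance makes kappa_eps / eps
   monotone, so that kappa is a genuine limit.  Applied to an eigenfunction on
   its steepest edge this gives lambda >= K for every nonzero eigenvalue.
   Applied along geodesics to d(x,.) and -d(.,y), for a diametral pair (x,y), it
   gives L u >= K (u - diam) >= 0 with u = d(x,.) + d(.,y); since L u has Perron
   mean zero, equality holds everywhere, and d(x,.) + H_x / K is an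
   eigenfunction for K. *)

(** * Bounds on finite sets and invariant measures of stochastic matrices *)

Lemma has_lbound_finite_image (R : realType) (T : finType) (E : set R)
    (h : T -> R) :
  (forall e, E e -> exists t, e = h t) -> has_lbound E.
Proof.
move=> hE; exists (- \sum_t `|h t|) => e /hE [t ->].
rewrite lerNl (le_trans (ler_norm _)) // normrN.
by rewrite (bigD1 t) //= lerDl sumr_ge0.
Qed.

Lemma has_ubound_finite_image (R : realType) (T : finType) (E : set R)
    (h : T -> R) :
  (forall e, E e -> exists t, e = h t) -> has_ubound E.
Proof.
move=> hE; exists (\sum_t `|h t|) => e /hE [t ->].
by rewrite (le_trans (ler_norm _)) // (bigD1 t) //= lerDl sumr_ge0.
Qed.

(** Unit row sums put the all-ones vector in the right kernel of [P - 1], so the determinant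
    vanishes and the left kernel is nontrivial as well. *)
Lemma stochastic_fixed_vector (R : realFieldType) (V : finType)
    (P : V -> V -> R) :
  (0 < #|V|)%N -> (forall x, \sum_y P x y = 1) ->
  exists g : V -> R, (exists x, g x != 0) /\
    forall x, g x = \sum_y g y * P y x.
Proof.
move=> V_gt0 P1.
pose M : 'M[R]_#|V| :=
  \matrix_(i, j) P (enum_val i) (enum_val j) - 1%:M.
have : \det M^T == 0.
  apply/det0P; exists (const_mx 1).
    apply/eqP => /rowP /(_ (Ordinal V_gt0)); rewrite !mxE.
    by apply/eqP; rewrite oner_eq0.
  rewrite linearB /= mulmxBr trmx1 mulmx1; apply/rowP => i; rewrite !mxE.
  apply/eqP; rewrite subr_eq0; apply/eqP; rewrite -[RHS](P1 (enum_val i)).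
  rewrite (big_enum_val (fun y => P (enum_val i) y)) /=.
  by apply: eq_bigr => j _; rewrite !mxE mul1r.
rewrite det_tr => /det0P [v v0 vM].
exists (fun x => v 0 (enum_rank x)); split.
  have [i vi] : exists i, v 0 i != 0.
    apply/existsP; apply: contraNT v0; rewrite negb_exists => /forallP v0.
    by apply/eqP/rowP => i; rewrite mxE; apply/eqP; move: (v0 i); rewrite negbK.
  by exists (enum_val i); rewrite enum_valK.
move=> x; move: vM; rewrite mulmxBr mulmx1 => /eqP; rewrite subr_eq0.
move=> /eqP /rowP /(_ (enum_rank x)) <-; rewrite !mxE.
rewrite (big_enum_val (fun y => v 0 (enum_rank y) * P y x)) /=.
by apply: eq_bigr => j _; rewrite !mxE enum_valK enum_rankK.
Qed.

(* If g is fixed, then |g| is subinvariant, hence invariant by comparing total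
   masses. *)
Lemma stochastic_invariant_prob (R : realType) (V : finType)
    (P : V -> V -> R) :
  (0 < #|V|)%N -> (forall x y, 0 <= P x y) -> (forall x, \sum_y P x y = 1) ->
  exists nu : V -> R, is_prob nu /\ forall x, nu x = \sum_y nu y * P y x.
Proof.
move=> V_gt0 P_ge0 P1.
have [g [[x0 gx0] gP]] := stochastic_fixed_vector _ _ _ V_gt0 P1.
pose s := \sum_x `|g x|.
have s_gt0 : 0 < s.
  by rewrite /s (bigD1 x0) //= ltr_wpDr ?sumr_ge0 ?normr_gt0.
have subinv x : 0 <= \sum_y `|g y| * P y x - `|g x|.
  rewrite subr_ge0 {1}gP (le_trans (ler_norm_sum _ _ _)) //.
  by apply: ler_sum => y _; rewrite normrM (ger0_norm (P_ge0 _ _)).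
have total : \sum_x (\sum_y `|g y| * P y x - `|g x|) = 0.
  rewrite sumrB exchange_big /=; apply/eqP; rewrite subr_eq0; apply/eqP.
  by apply: eq_bigr => y _; rewrite -mulr_sumr P1 mulr1.
exists (fun x => `|g x| / s); split.
  split=> [x|]; first by rewrite divr_ge0 // ltW.
  by rewrite -mulr_suml divff // gt_eqF.
move=> x; have /eqP := psumr_eq0P (fun x _ => subinv x) total (i := x) isT.
rewrite subr_eq0 => /eqP <-; rewrite mulr_suml.
by apply: eq_bigr => y _; rewrite mulrAC.
Qed.

(** * The directed distance *)

Section Distance.
Context {R : realType} {V : finType} (mu : V -> V -> R).

Lemma dist_le_size x p :
  path (edge mu) x p -> (dist mu x (last x p) <= size p)%N.
Proof.
move=> xp; rewrite /dist; case: pselect => // ex.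
case: ex_minnP => m _; apply.
by apply/existsP; exists (in_tuple p); rewrite xp eqxx.
Qed.

Lemma distxx x : dist mu x x = 0%N.
Proof. by apply/eqP; rewrite -leqn0; apply: (@dist_le_size x [::]). Qed.

Hypothesis mu_conn : strongly_connected mu.

Lemma dist_path x y :
  exists p, [/\ path (edge mu) x p, last x p = y & size p = dist mu x y].
Proof.
(* Strong connectivity rules out the default value 0 of [dist]. *)
rewrite /dist; case: pselect => [ex|[]]; last exact: mu_conn.
case: ex_minnP => m /existsP [p /andP [xp /eqP yp]] _.
by exists p; rewrite size_tuple.
Qed.

Lemma dist_triangle x y z : (dist mu x z <= dist mu x y + dist mu y z)%N.
Proof.
have [p [xp yp <-]] := dist_path x y; have [q [yq zq <-]] := dist_path y z.
rewrite -size_cat -zq -yp -last_cat; apply: dist_le_size.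
by rewrite cat_path xp yp.
Qed.

Lemma dist_eq0 x y : (dist mu x y == 0)%N = (x == y).
Proof.
apply/eqP/eqP => [d0|->]; last exact: distxx.
by have [p [_ yp]] := dist_path x y; rewrite d0 -yp => /size0nil ->.
Qed.

Lemma dist_edge_le1 x y : edge mu x y -> (dist mu x y <= 1)%N.
Proof.
by move=> xy; apply: (@dist_le_size x [:: y]); rewrite /= xy.
Qed.

End Distance.

(** * Lipschitz functions and the Wasserstein distance *)

Section Wasserstein.
Context {R : realType} {V : finType} (mu : V -> V -> R).
Hypothesis mu_conn : strongly_connected mu.

(* By strong connectivity this is the 1-Lipschitz condition for the directed
   distance. *)
Definition lip1 (f : V -> R) : Prop :=
  forall x y, edge mu x y -> f y - f x <= 1.

Lemma lip1_path f x p :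
  lip1 f -> path (edge mu) x p -> f (last x p) - f x <= (size p)%:R.
Proof.
move=> fL; elim: p x => [|z p IH] x /=; first by rewrite subrr.
move=> /andP [/fL xz /IH zp]; rewrite -natr1; lra.
Qed.

Lemma lip1_dist f x y : lip1 f -> f y - f x <= (dist mu x y)%:R.
Proof.
by move=> fL; have [p [xp <- <-]] := dist_path _ mu_conn x y; apply: lip1_path.
Qed.

Lemma lip1_dist_from x : lip1 (fun z => (dist mu x z)%:R).
Proof.
move=> z w zw; rewrite lerBlDr nat1r ler_nat -add1n addnC.
apply: leq_trans (dist_triangle _ mu_conn x z w) _.
by rewrite leq_add2l dist_edge_le1.
Qed.

Lemma lip1_dist_to y : lip1 (fun z => - (dist mu z y)%:R).
Proof.
move=> z w zw; rewrite opprK addrC lerBlDr nat1r ler_nat -add1n.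
apply: leq_trans (dist_triangle _ mu_conn z w y) _.
by rewrite leq_add2r dist_edge_le1.
Qed.

Lemma coupling_prod (nu0 nu1 : V -> R) : is_prob nu0 -> is_prob nu1 ->
  coupling nu0 nu1 (fun x y => nu0 x * nu1 y).
Proof.
move=> [p0 s0] [p1 s1]; split=> [x y|x|y]; first exact: mulr_ge0.
- by rewrite -mulr_sumr s1 mulr1.
- by rewrite -mulr_suml s0 mul1r.
Qed.

(** The marginal conditions turn the left side into the sum of [(f y - f x) * pi x y], which is
    bounded term by term. *)
Lemma cost_ge_lip1 (f nu0 nu1 : V -> R) pi : lip1 f -> coupling nu0 nu1 pi ->
  \sum_x f x * nu1 x - \sum_x f x * nu0 x <= cost mu pi.
Proof.
move=> fL [pi_ge0 pi0 pi1].
rewrite (eq_bigr (fun y => \sum_x f y * pi x y)); last first.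
  by move=> y _; rewrite -mulr_sumr pi1.
rewrite exchange_big /= -sumrB; apply: ler_sum => x _.
rewrite -pi0 mulr_sumr -sumrB; apply: ler_sum => y _.
by rewrite -mulrBl ler_wpM2r // lip1_dist.
Qed.

Lemma wasserstein_ge_lip1 (f nu0 nu1 : V -> R) :
    lip1 f -> is_prob nu0 -> is_prob nu1 ->
  \sum_x f x * nu1 x - \sum_x f x * nu0 x <= wasserstein mu nu0 nu1.
Proof.
move=> fL p0 p1; apply: lb_le_inf.
  by exists (cost mu (fun x y => nu0 x * nu1 y)), (fun x y => nu0 x * nu1 y);
    first exact: coupling_prod.
by move=> _ [pi cpi <-]; apply: cost_ge_lip1.
Qed.

Lemma wasserstein_le (nu0 nu1 : V -> R) pi :
  coupling nu0 nu1 pi -> wasserstein mu nu0 nu1 <= cost mu pi.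
Proof.
move=> cpi; apply: ge_inf; last by exists pi.
exists 0 => _ [rho [rho_ge0 _ _] <-].
by apply: sumr_ge0 => x _; apply: sumr_ge0 => y _; apply: mulr_ge0.
Qed.

Lemma sum_delta (x : V) (F : V -> R) : \sum_z (z == x)%:R * F z = F x.
Proof.
rewrite (bigD1 x) //= eqxx mul1r big1 ?addr0 // => z /negPf ->.
by rewrite mul0r.
Qed.

Lemma sum_delta1 (x : V) : \sum_z (z == x)%:R = 1 :> R.
Proof.
by rewrite -[RHS](sum_delta x (fun=> 1)); apply: eq_bigr => z _; rewrite mulr1.
Qed.

Lemma wasserstein_mix_dirac (nu0 nu1 : V -> R) (t : R) x y :
    is_prob nu0 -> is_prob nu1 -> 0 < t -> t <= 1 ->
  wasserstein mu (fun z => (1 - t) * (z == x)%:R + t * nu0 z)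
                 (fun z => (1 - t) * (z == y)%:R + t * nu1 z)
    <= (1 - t) * (dist mu x y)%:R + t * wasserstein mu nu0 nu1.
Proof.
move=> p0 p1 t_gt0 t_le1.
(* Isolating the infimum on the right reduces the bound to a single arbitrary coupling [pi]. *)
rewrite -lerBlDl [t * wasserstein _ _ _]mulrC -ler_pdivrMr //; apply: lb_le_inf.
  by exists (cost mu (fun x y => nu0 x * nu1 y)), (fun x y => nu0 x * nu1 y);
    first exact: coupling_prod.
move=> _ [pi [pi_ge0 pi0 pi1] <-]; rewrite ler_pdivrMr // lerBlDl [_ * t]mulrC.
(* Mixing [pi] with the Dirac mass at [(x, y)] couples the two mixtures, and the cost is affine. *)
pose rho v w : R := (1 - t) * ((v == x)%:R * (w == y)%:R) + t * pi v w.
have -> : (1 - t) * (dist mu x y)%:R + t * cost mu pi = cost mu rho.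
  rewrite /cost mulr_sumr -(sum_delta x (fun v => (dist mu v y)%:R)).
  rewrite mulr_sumr -big_split; apply: eq_bigr => v _ /=.
  rewrite -(sum_delta y (fun w => (dist mu v w)%:R)) !mulr_sumr -big_split.
  by apply: eq_bigr => w _ /=; rewrite /rho; ring.
apply: wasserstein_le; split=> [v w|v|w].
- by rewrite addr_ge0 ?mulr_ge0 ?subr_ge0 ?ler0n // ltW.
- by rewrite big_split /= -!mulr_sumr pi0 sum_delta1 mulr1.
- by rewrite big_split /= -!mulr_sumr pi1 -mulr_suml sum_delta1 mul1r.
Qed.

End Wasserstein.

(** * The Perron measure and the Chung Laplacian *)

Section ChungLaplacian.
Context {R : realType} {V : finType} (mu : V -> V -> R).
Hypothesis card_V : (2 <= #|V|)%N.
Hypothesis mu_ge0 : forall x y, 0 <= mu x y.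
Hypothesis mu_conn : strongly_connected mu.

Local Notation m := (perron mu).
Local Notation L := (laplacian mu).

Lemma exists_neq (x : V) : exists y, y != x.
Proof.
have /card_gt0P [y] : (0 < #|predC1 x|)%N by rewrite cardC1 -subn1 subn_gt0.
by exists y.
Qed.

Lemma vweight_gt0 x : 0 < vweight mu x.
Proof.
have [y yx] := exists_neq x.
have [[|z p] [xp py _]] := dist_path mu mu_conn x y.
  by rewrite -py eqxx in yx.
case/andP: xp => xz _; rewrite /vweight (bigD1 z) //=.
by rewrite ltr_wpDr ?sumr_ge0.
Qed.

Lemma transP_ge0 x y : 0 <= transP mu x y.
Proof. by rewrite divr_ge0 // ltW // vweight_gt0. Qed.

Lemma sum_transP x : \sum_y transP mu x y = 1.
Proof. by rewrite -mulr_suml divff // gt_eqF // vweight_gt0. Qed.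

Lemma perronP : is_prob m /\ stationary mu m.
Proof.
have V_gt0 : (0 < #|V|)%N by apply: leq_trans card_V.
have [nu [[nu_ge0 nu1] nuP]] :=
  stochastic_invariant_prob R V (transP mu) V_gt0 transP_ge0 sum_transP.
apply: (@xgetPex _ [ffun=> 0]
  [set nu : {ffun V -> R} | is_prob nu /\ stationary mu nu]%classic).
exists [ffun x => nu x]; split.
  by split=> [x|]; [rewrite ffunE | under eq_bigr do rewrite ffunE].
by move=> x; under eq_bigr do rewrite ffunE; rewrite ffunE.
Qed.

(** Total mass 1 gives some vertex positive mass, and stationarity propagates positivity along
    edges. *)
Lemma perron_gt0 x : 0 < m x.
Proof.
have [[m_ge0 m1] mP] := perronP.
have [x0 mx0] : exists x0, 0 < m x0.
  apply/existsP; apply: contraT; rewrite negb_exists => /forallP m0.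
  move: m1; rewrite big1 => [/eqP|y _]; first by rewrite eq_sym oner_eq0.
  by apply/eqP; move: (m0 y); rewrite lt_neqAle m_ge0 andbT eq_sym negbK.
have [p [xp <- _]] := dist_path mu mu_conn x0 x.
elim: p x0 mx0 xp => [|y p IH] //= z mz /andP [zy yp]; apply: IH yp.
rewrite mP (bigD1 z) //= ltr_wpDr //.
  by apply: sumr_ge0 => w _; rewrite mulr_ge0 // transP_ge0.
by rewrite mulr_gt0 // divr_gt0 // vweight_gt0.
Qed.

Lemma meanP_ge0 x y : 0 <= meanP mu x y.
Proof.
rewrite divr_ge0 // addr_ge0 ?transP_ge0 // mulr_ge0 ?transP_ge0 //.
by rewrite divr_ge0 // ltW // perron_gt0.
Qed.

Lemma sum_meanP x : \sum_y meanP mu x y = 1.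
Proof.
rewrite -mulr_suml big_split /= sum_transP.
under [X in 1 + X]eq_bigr => y _ do rewrite /revP mulrAC.
rewrite -mulr_suml -(perronP.2 x) divff ?gt_eqF ?perron_gt0 //.
by rewrite -mulr2n divff // pnatr_eq0.
Qed.

Lemma sum_perron_meanP y : \sum_x m x * meanP mu x y = m y.
Proof.
(* Weighting by [m] symmetrizes the kernel: one half sums to [m y] by stationarity, the other by
   unit row sums. *)
rewrite (eq_bigr (fun x => (m x * transP mu x y + m y * transP mu y x) / 2)).
  rewrite -mulr_suml big_split /= -mulr_sumr sum_transP -(perronP.2 y) mulr1.
  by rewrite -mulr2n -[m y *+ 2]mulr_natr mulfK // pnatr_eq0.
move=> x _; rewrite /meanP /revP; field.
by rewrite gt_eqF ?perron_gt0.
Qed.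

Lemma sum_perron_laplacian f : \sum_x m x * L f x = 0.
Proof.
under eq_bigr do rewrite mulrBr mulr_sumr.
rewrite sumrB exchange_big /=; apply/eqP; rewrite subr_eq0; apply/eqP.
apply: eq_bigr => y _; under eq_bigr do rewrite mulrA.
by rewrite -mulr_suml sum_perron_meanP.
Qed.

Lemma laplacianD f g x : L (f \+ g) x = L f x + L g x.
Proof.
rewrite /laplacian /=; under eq_bigr do rewrite mulrDr.
by rewrite big_split /=; ring.
Qed.

Lemma laplacianZ a f x : L (fun z => a * f z) x = a * L f x.
Proof.
rewrite /laplacian mulrBr mulr_sumr; congr (_ - _).
by apply: eq_bigr => y _; ring.
Qed.

Lemma laplacianN f x : L (fun z => - f z) x = - L f x.
Proof.
rewrite -mulN1r -laplacianZ; congr (L _ x).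
by apply: funext => z; rewrite mulN1r.
Qed.

Lemma laplacian_cst c x : L (fun=> c) x = 0.
Proof. by rewrite /laplacian -mulr_suml sum_meanP mul1r subrr. Qed.

(** * Lazy walks and the limit defining the Ricci curvature *)

Lemma lazy_walk_prob eps x :
  0 <= eps -> eps <= 1 -> is_prob (lazy_walk mu eps x).
Proof.
move=> eps_ge0 eps_le1; split=> [z|].
  by apply: addr_ge0; apply: mulr_ge0; rewrite ?subr_ge0 ?ler0n ?meanP_ge0.
by rewrite big_split /= -!mulr_sumr sum_delta1 sum_meanP; ring.
Qed.

Lemma sum_lazy_walk f eps x :
  \sum_z f z * lazy_walk mu eps x z = f x - eps * L f x.
Proof.
rewrite (eq_bigr (fun z =>
    (1 - eps) * ((z == x)%:R * f z) + eps * (meanP mu x z * f z))).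
  by rewrite big_split /= -!mulr_sumr sum_delta /laplacian; ring.
by move=> z _; rewrite /lazy_walk; ring.
Qed.

(** Testing against [f] gives a Wasserstein distance of at least
    [dist mu x y - eps * (L f y - L f x)]. *)
Lemma kappa_eps_le f eps x y :
    x != y -> lip1 mu f -> f y - f x = (dist mu x y)%:R ->
    0 < eps -> eps <= 1 ->
  kappa_eps mu eps x y / eps <= (L f y - L f x) / (dist mu x y)%:R.
Proof.
move=> xy fL fxy eps_gt0 eps_le1; have eps_ge0 := ltW eps_gt0.
have := wasserstein_ge_lip1 mu mu_conn f _ _ fL
  (lazy_walk_prob _ x eps_ge0 eps_le1) (lazy_walk_prob _ y eps_ge0 eps_le1).
rewrite !sum_lazy_walk /kappa_eps; set W := wasserstein _ _ _; set d := _%:R.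
move=> hW; have d_gt0 : 0 < d by rewrite ltr0n lt0n dist_eq0.
rewrite ler_pdivrMr // -(ler_pM2r d_gt0) mulrBl mul1r divfK ?gt_eqF //.
rewrite mulrAC divfK ?gt_eqF //; move: fxy; rewrite -/d; lra.
Qed.

(** The walk with parameter [a] is the mixture, with weight [a / b], of the Dirac mass and the walk
    with parameter [b], so convexity applies. *)
Lemma kappa_eps_slope_mono a b x y : x != y -> 0 < a -> a <= b -> b <= 1 ->
  kappa_eps mu b x y / b <= kappa_eps mu a x y / a.
Proof.
move=> xy a_gt0 ab b_le1; have b_gt0 := lt_le_trans a_gt0 ab.
have t_gt0 : 0 < a / b by rewrite divr_gt0.
have t_le1 : a / b <= 1 by rewrite ler_pdivrMr // mul1r.
have := wasserstein_mix_dirac mu _ _ _ x y (lazy_walk_prob _ x (ltW b_gt0) b_le1)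
  (lazy_walk_prob _ y (ltW b_gt0) b_le1) t_gt0 t_le1.
have mixE v : (fun z => (1 - a / b) * (z == v)%:R + a / b * lazy_walk mu b v z)
    = lazy_walk mu a v.
  by apply: funext => z; rewrite /lazy_walk; field; rewrite gt_eqF.
rewrite !mixE /kappa_eps; set Wa := wasserstein _ _ _.
set Wb := wasserstein _ _ _; set d := _%:R => hW.
have d_gt0 : 0 < d by rewrite ltr0n lt0n dist_eq0.
rewrite ler_pdivlMr // mulrAC -mulrA -mulrC -(ler_pM2r d_gt0).
rewrite -mulrA !mulrBl !mul1r !divfK ?gt_eqF //; move: hW; lra.
Qed.

Lemma kappa_le f x y :
    x != y -> lip1 mu f -> f y - f x = (dist mu x y)%:R ->
  kappa mu x y <= (L f y - L f x) / (dist mu x y)%:R.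
Proof.
move=> xy fL fxy; apply: limr_le.
  (* The quotients increase as [eps] decreases to 0 and are bounded above, so [lim] is a true
     limit. *)
  apply: cvgP; apply: (@nonincreasing_at_right_cvgr _ _ _ (BRight 1)).
  - by rewrite bnd_simp.
  - move=> a b; rewrite !in_itv /= => /andP [a_gt0 _] /andP [_ b_le1] ab.
    exact: kappa_eps_slope_mono.
  - exists ((L f y - L f x) / (dist mu x y)%:R) => _ [eps /= + <-].
    rewrite in_itv /= => /andP [eps_gt0 eps_le1].
    exact: kappa_eps_le.
near=> eps; apply: kappa_eps_le => //.
by near: eps; exact: nbhs_right_le.
Unshelve. all: by end_near. Qed.

(** * Curvature bounds for the Laplacian and its eigenvalues *)

Hypothesis mu_simple : forall x, mu x x = 0.
Local Notation K := (inf_ricci mu).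

Lemma inf_ricci_le_kappa x y : edge mu x y -> K <= kappa mu x y.
Proof.
move=> xy; apply: ge_inf; last by exists x, y.
apply: (@has_lbound_finite_image _ (V * V)%type _ (fun p => kappa mu p.1 p.2)).
by move=> _ [a [b [_ ->]]]; exists (a, b).
Qed.

Lemma mean_curv_le_sup x y : mean_curv mu x y <= sup_mean_curv mu.
Proof.
apply: ub_le_sup; last by exists x, y.
apply: (@has_ubound_finite_image _ (V * V)%type _
  (fun p => mean_curv mu p.1 p.2)).
by move=> _ [a [b ->]]; exists (a, b).
Qed.

Lemma dist_edge x y : edge mu x y -> dist mu x y = 1%N.
Proof.
move=> xy; apply/eqP; rewrite eqn_leq dist_edge_le1 // lt0n dist_eq0 //.
by apply: contraL xy => /eqP ->; rewrite /edge mu_simple ltxx.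
Qed.

Lemma inf_ricci_le_laplacian_edge f x y :
  lip1 mu f -> edge mu x y -> f y - f x = 1 -> K <= L f y - L f x.
Proof.
move=> fL xy fxy; apply: le_trans (inf_ricci_le_kappa _ _ xy) _.
have d1 := dist_edge _ _ xy.
have := kappa_le f x y; rewrite d1 divr1; apply => //.
by rewrite -(dist_eq0 mu) // d1.
Qed.

(* A 1-Lipschitz function growing at maximal speed along a path grows by exactly
   1 on each edge, so the edge estimates telescope. *)
Lemma inf_ricci_le_laplacian_path f x p :
    lip1 mu f -> path (edge mu) x p -> f (last x p) - f x = (size p)%:R ->
  K * (size p)%:R <= L f (last x p) - L f x.
Proof.
move=> fL; elim: p x => [|z p IH] x /=; first by rewrite mulr0 !subrr.
move=> /andP [xz zp]; rewrite -natr1 => fE.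
have fxz := fL _ _ xz; have fzp := lip1_path _ _ _ _ fL zp.
have hxz : K <= L f z - L f x by apply: inf_ricci_le_laplacian_edge => //; lra.
have hzp : K * (size p)%:R <= L f (last z p) - L f z by apply: IH => //; lra.
by rewrite mulrDr mulr1; lra.
Qed.

Lemma inf_ricci_le_laplacian f x y :
    lip1 mu f -> f y - f x = (dist mu x y)%:R ->
  K * (dist mu x y)%:R <= L f y - L f x.
Proof.
have [p [xp <- <-]] := dist_path mu mu_conn x y.
by move=> fL; apply: inf_ricci_le_laplacian_path.
Qed.

(** The distance from [x] attains its Lipschitz bound between [x] and every [z]. *)
Lemma laplacian_dist_from x z :
  K * (dist mu x z)%:R + mean_curv_out mu x <= L (fun w => (dist mu x w)%:R) z.
Proof.
rewrite -lerBrDr; apply: inf_ricci_le_laplacian.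
  exact: lip1_dist_from.
by rewrite distxx subr0.
Qed.

Lemma laplacian_dist_to y z :
  K * (dist mu z y)%:R + mean_curv_in mu y <= L (fun w => (dist mu w y)%:R) z.
Proof.
have := inf_ricci_le_laplacian _ z y (lip1_dist_to mu mu_conn y).
rewrite distxx oppr0 sub0r opprK !laplacianN => /(_ erefl).
rewrite /mean_curv_in; lra.
Qed.

(* Lichnerowicz: rescale an eigenfunction so that its steepest edge has slope
   exactly 1. *)
Lemma inf_ricci_le_eigenvalue a : a != 0 -> is_eigenvalue mu a -> K <= a.
Proof.
move=> a0 [f [[x0 fx0] fE]].
have [e0 e0P] : exists e : V * V, edge mu e.1 e.2.
  have [y] : exists y, mu x0 y != 0.
    apply/existsP; apply: contraTT (vweight_gt0 x0).
    rewrite negb_exists => /forallP mu0; rewrite -leNgt /vweight big1 // => y _.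
    by apply/eqP; move: (mu0 y); rewrite negbK.
  by move=> mu0; exists (x0, y); rewrite /edge lt_neqAle mu_ge0 eq_sym mu0.
case: (@arg_maxP _ _ _ e0 (fun e => edge mu e.1 e.2)
  (fun e => f e.2 - f e.1) e0P) => -[u v] /= uv slope_max.
pose C := f v - f u.
have fle z w : edge mu z w -> f w - f z <= C by apply: (slope_max (z, w)).
(* Otherwise [f] is nonincreasing along all paths, hence constant by strong connectivity; then [L f]
   vanishes, against [a != 0] and [f x0 != 0]. *)
have C_gt0 : 0 < C.
  rewrite ltNge; apply: contra fx0 => C_le0.
  have mono z w : f w <= f z.
    have [p [zp <- _]] := dist_path mu mu_conn z w.
    elim: p z zp => //= t p IH z /andP [/fle zt /IH tp]; lra.
  have fc : f = fun=> f x0.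
    by apply: funext => z; apply/eqP; rewrite eq_le !mono.
  have /eqP := fE x0; rewrite {1}fc laplacian_cst eq_sym mulf_eq0.
  by rewrite (negPf a0).
pose g z := C^-1 * f z.
have gL : lip1 mu g.
  by move=> z w zw; rewrite -mulrBr mulrC ler_pdivrMr // mul1r fle.
have guv : g v - g u = 1 by rewrite -mulrBr mulVf // gt_eqF.
have := inf_ricci_le_laplacian_edge g _ _ gL uv guv.
by rewrite !laplacianZ !fE -mulrBr -mulrBr mulrCA mulVf ?gt_eqF // mulr1.
Qed.

(** * Rigidity at maximal diameter *)

Lemma is_eigenvalue_inf_ricci :
    0 < K -> (diam mu)%:R = sup_mean_curv mu / K ->
  is_eigenvalue mu K.
Proof.
move=> K_gt0 diam_max.
have [x [y diamE]] : exists x y, diam mu = dist mu x y.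
  have VV_gt0 : (0 < #|{: V * V}|)%N.
    by rewrite card_prod muln_gt0 andbb (leq_trans _ card_V).
  have [e eE] := bigop.eq_bigmax (fun e : V * V => dist mu e.1 e.2) VV_gt0.
  by exists e.1, e.2.
have KD : K * (dist mu x y)%:R = sup_mean_curv mu.
  by rewrite -diamE diam_max mulrC divfK // gt_eqF.
have curv_le := mean_curv_le_sup x y.
pose Lu z := L (fun w => (dist mu x w)%:R) z + L (fun w => (dist mu w y)%:R) z.
(* The two comparison bounds add up to at least [K * dist mu x y - mean_curv mu x y], which is
   nonnegative because [KD] identifies the first term with the supremum of the mean curvature. *)
have Lu_ge0 z : 0 <= Lu z.
  have tri : K * (dist mu x y)%:R <= K * ((dist mu x z)%:R + (dist mu z y)%:R).
    by rewrite ler_pM2l // -natrD ler_nat dist_triangle.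
  have := laplacian_dist_from x z; have := laplacian_dist_to y z.
  by move: tri curv_le; rewrite mulrDr KD /mean_curv /Lu; lra.
have mLu : \sum_z m z * Lu z = 0.
  under eq_bigr do rewrite mulrDr.
  by rewrite big_split /= !sum_perron_laplacian addr0.
have Lu0 z : Lu z = 0.
  have mLu_ge0 w : 0 <= m w * Lu w by rewrite mulr_ge0 // ltW // perron_gt0.
  have /eqP := psumr_eq0P (fun w _ => mLu_ge0 w) mLu (i := z) isT.
  by rewrite mulf_eq0 gt_eqF ?perron_gt0 //= => /eqP.
(* As [Lu] vanishes, the lower bound for the distance to [y] becomes an upper bound here; the
   triangle inequality and [KD] match it with the lower bound. *)
have LE z : L (fun w => (dist mu x w)%:R) z =
    K * (dist mu x z)%:R + mean_curv_out mu x.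
  have tri : K * (dist mu x y)%:R <= K * ((dist mu x z)%:R + (dist mu z y)%:R).
    by rewrite ler_pM2l // -natrD ler_nat dist_triangle.
  apply/eqP; rewrite eq_le laplacian_dist_from andbT.
  have := laplacian_dist_to y z; have := Lu0 z.
  by move: tri curv_le; rewrite mulrDr KD /mean_curv /Lu; lra.
(* This shift absorbs the constant term: the right side of [LE] is [K * (dist mu x z + c)]. *)
pose c := mean_curv_out mu x / K.
exists (fun w => (dist mu x w)%:R + c); split.
  have [z zx] := exists_neq x.
  (* If the function vanishes at [x] then [c = 0], and it is positive at any other vertex. *)
  case: (eqVneq ((dist mu x x)%:R + c) 0) => [fx0|]; last by exists x.
  exists z; move: fx0; rewrite distxx add0r => ->.
  by rewrite addr0 pnatr_eq0 dist_eq0 // eq_sym.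
move=> z; rewrite (laplacianD (fun w => (dist mu x w)%:R) (fun=> c)).
by rewrite laplacian_cst LE addr0 mulrDr /c [K * (_ / _)]mulrC divfK // gt_eqF.
Qed.

End ChungLaplacian.

Theorem theorem4p5 (R : realType) (V : finType) (mu : V -> V -> R)
    (card_V : (2 <= #|V|)%N)
    (mu_ge0 : forall x y : V, 0 <= mu x y)
    (mu_simple : forall x : V, mu x x = 0)
    (mu_conn : strongly_connected mu)
    (K_gt0 : 0 < inf_ricci mu)
    (diam_max : (diam mu)%:R = sup_mean_curv mu / inf_ricci mu) :
  lambda1 mu = inf_ricci mu.
Proof.
have K_eig : [set a | a != 0 /\ is_eigenvalue mu a]%classic (inf_ricci mu).
  by split; [rewrite gt_eqF | apply: is_eigenvalue_inf_ricci].
have K_lb : lbound [set a | a != 0 /\ is_eigenvalue mu a]%classic (inf_ricci mu).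
  by move=> a [a0 a_eig]; apply: inf_ricci_le_eigenvalue.
(* The curvature bound is both a member and a lower bound of the set of nonzero eigenvalues, hence
   its infimum. *)
apply/eqP; rewrite eq_le (lb_le_inf _ K_lb) ?andbT; last by exists (inf_ricci mu).
by apply: ge_inf K_eig; exists (inf_ricci mu).
Qed.
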